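(* Let $1\le r\le n$ and let $(\mathbf X^s,\mathbf U^s)$ be a stationary pair of stochastic processes, with $\varrho^s_X$ the law of $X^s(k)$. Assume the stochastic optimal control problem has the Wasserstein turnpike property of order $r$ with respect to $(\mathbf X^s,\mathbf U^s)$, i.e. the distributional turnpike property with $d_D$ the Wasserstein distance of order $r$. Then it has the $s$-th moment turnpike property with respect to $(\mathbf X^s,\mathbf U^s)$ for all $1\le s\le r$.
   Context: Setting. $\mathcal X,\mathcal U,\mathcal W$ are separable Banach spaces, $\|\cdot\|$ is the norm of $\mathcal X$, $(\Omega,\mathcal F,\mathbb P)$ is a probability space, $n,l\ge 1$ are fixed exponents, and $L^n(\Omega,\mathcal F,\mathbb P;\mathcal X)$ is the space of $\mathcal X$-valued random variables with finite $n$-th moment. $f:\mathcal X\times\mathcal U\times\mathcal W\to\mathcal X$ is continuous in $(x,u)$ for almost all $w$. $\mathbf W=(W(0),W(1),\dots)$ is a fixed i.i.d. sequence with distribution $\varrho_W$. The control system is $X(k+1)=f(X(k),U(k),W(k))$, $X(0)=X_0$, with $X(k)\in L^n(\Omega,\mathcal F_k,\mathbb P;\mathcal X)$, $U(k)\in L^l(\Omega,\mathcal F_k,\mathbb P;\mathcal U)$, $\mathcal F_k=\sigma(X(0),\dots,X(k))$; it is always required that $W(k)$ is independent of $(X(k),U(k))$. The trajectory is denoted $X_{\mathbf U}(k,X_0)$ or $X(k)$. The constraint set $\mathbb Y\subseteq L^n(\Omega,\mathcal F,\mathbb P;\mathcal X)\times L^l(\Omega,\mathcal F,\mathbb P;\mathcal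 U)$ is law-invariant (if $(X,U)\in\mathbb Y$ and $(Y,V)$ has the same joint law as $(X,U)$, then $(Y,V)\in\mathbb Y$); $\mathbb X:=\{X : \exists U,\ (X,U)\in\mathbb Y\}$. $\mathbb U^N(X_0)$ is the set of admissible control sequences $\mathbf U=(U(0),\dots,U(N-1))$ for $X_0\in\mathbb X$: $U(k)\in L^l(\Omega,\mathcal F_k,\mathbb P;\mathcal U)$, $(X(k),U(k))\in\mathbb Y$ for $k=0,\dots,N-1$, and $X(N)\in\mathbb X$; $\mathbb U^\infty(X_0)$ is defined analogously for infinite sequences ($(X(k),U(k))\in\mathbb Y$ for all $k\in\mathbb N_0$). It is assumed that $\mathbb U^\infty(X_0)\ne\emptyset$ for all $X_0\in\mathbb X$. The stage cost $\ell:\mathbb Y\to\mathbb R$ is law-invariant ($\ell(X,U)$ depends only on the joint law of $(X,U)$). Markov policies. $\Pi_0(\mathcal X,\mathcal U)$ is the set of (measurable) maps $\pi:\mathcal X\to\mathcal U$ with $\pi\circ X\in L^l(\Omega,\mathcal F,\mathbb P;\mathcal U)$ for all $X\in L^n(\Omega,\mathcal F,\mathbb P;\mathcal X)$. $\mathbb F^N(X_0)$ (for $N\in\mathbb N\cup\{\infty\}$) is the set of $\mathbf U\in\mathbb U^N(X_0)$ such that for every $k<N$ there is $\pi_k\in\Pi_0(\mathcal X,\mathcal U)$ with $U(k)=\pi_k(X(k))$. The stochastic optimal control problem is to minimize $J_N(X_0,\mathbf U)=\sum_{k=0}^{N-1}\ell(X(k),U(k))$ over $\mathbf U\in\mathbb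 F^N(X_0)$. Stationary pair. $(\mathbf X^s,\mathbf U^s)$ with $X^s(k+1)=f(X^s(k),U^s(k),W(k))$ (same noise $\mathbf W$), $\mathbf U^s\in\mathbb F^\infty(X^s(0))$, is stationary if the laws of $X^s(k)$, of $U^s(k)$ and of $(X^s(k),U^s(k))$ do not depend on $k\in\mathbb N_0$. Then $\ell(\mathbf X^s,\mathbf U^s)$ denotes the $k$-independent value $\ell(X^s(k),U^s(k))$. $\mathcal K_\infty$ is the set of continuous, strictly increasing, unbounded $\alpha:[0,\infty)\to[0,\infty)$ with $\alpha(0)=0$. $P_X$ denotes the law of $X$; $\mathcal P_n(\mathcal X)$ is the set of Borel probability measures on $\mathcal X$ with finite $n$-th moment. Distributional turnpike property with respect to a metric $d_D$ on $\mathcal P_n(\mathcal X)$: there exists $\alpha_3\in\mathcal K_\infty$ such that for each $X_0\in\mathbb X$ there is $C_c>0$ such that for each $\delta>0$, $N\in\mathbb N$, each $\mathbf U\in\mathbb F^N(X_0)$ with $J_N(X_0,\mathbf U)\le\delta+N\ell(\mathbf X^s,\mathbf U^s)$ and each $\varepsilon>0$, $$\#\{k\in\{0,\dots,N\} : d_D(P_{X_{\mathbf U}(k,X_0)},\varrho^s_X)\le\varepsilon\}\ \ge\ N-\frac{\delta+C_c}{\alpha_3(\varepsilon)}.$$ Wasserstein distance of order $r$: $d_{W_r}(P_X,P_Y)=\inf\{(\mathbb E[\|\bar X-\bar Y\|^r])^{1/r}:\bar X\sim P_X,\ \bar Y\sim P_Y\}$ (infimum over all couplings). $s$-th moment turnpike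 property: there exists $\alpha_4\in\mathcal K_\infty$ such that for each $X_0\in\mathbb X$ there is $C_d>0$ such that for each $\delta>0$, $N\in\mathbb N$, each $\mathbf U\in\mathbb F^N(X_0)$ with $J_N(X_0,\mathbf U)\le\delta+N\ell(\mathbf X^s,\mathbf U^s)$ and each $\varepsilon>0$, $$\#\Big\{k\in\{0,\dots,N\} : \Big|\mathbb E[\|X_{\mathbf U}(k,X_0)\|^s]^{1/s}-\mathbb E[\|X^s(k)\|^s]^{1/s}\Big|\le\varepsilon\Big\}\ \ge\ N-\frac{\delta+C_d}{\alpha_4(\varepsilon)}.$$ (The superscript in $X^s$ is part of the name of the stationary process and is unrelated to the order $s$.) *)

(* Defs.v *)
From HB Require Import structures.
From mathcomp Require Import all_boot all_order all_algebra.
From mathcomp Require Import all_classical all_reals all_analysis.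

Set Implicit Arguments.
Unset Strict Implicit.
Unset Printing Implicit Defensive.

Import Order.TTheory GRing.Theory Num.Theory.
Import numFieldNormedType.Exports.

Local Open Scope classical_set_scope.
Local Open Scope ring_scope.

Notation borel T := (g_sigma_algebraType (@open T)).

Definition separable (T : topologicalType) : Prop :=
  exists2 D : set T, countable D & dense D.

Section Laws.
Context {R : realType} {d : measure_display} {Omega : measurableType d}.
Variable P : probability Omega R.

(* Two measures over Borel sets are compared on measurable sets only: a
   library measure is a function of all sets, with unspecified values on the
   nonmeasurable ones. *)
Definition same_law {d'} {T : measurableType d'} (X Y : Omega -> T) : Prop :=
  forall A, measurable A -> pushforward P X A = pushforward P Y A.

Definition independent {d1 d2} {T1 : measurableType d1}
    {T2 : measurableType d2} (X : Omega -> T1) (Y : Omega -> T2) : Prop :=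
  forall A B, measurable A -> measurable B ->
    P (X @^-1` A `&` Y @^-1` B) = (P (X @^-1` A) * P (Y @^-1` B))%E.

(* Taking [B k := setT] for some of the indices gives the product rule for
   every finite subfamily. *)
Definition mutually_independent {d'} {T : measurableType d'}
    (W : nat -> Omega -> T) : Prop :=
  forall (N : nat) (B : nat -> set T), (forall k, measurable (B k)) ->
    P (\bigcap_(k in `I_N) (W k @^-1` B k))
    = (\prod_(k < N) P (W k @^-1` B k))%E.

(* The sigma-algebra generated by the [X j] with [j] in [J]. *)
Definition sigma_gen {d'} {T : measurableType d'} (J : set nat)
    (X : nat -> Omega -> T) : set (set Omega) :=
  <<s \bigcup_(j in J) preimage_set_system [set: Omega] (X j) measurable >>.

Definition independent_of_sequence {d1 d2} {T1 : measurableType d1}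
    {T2 : measurableType d2} (X : Omega -> T1) (W : nat -> Omega -> T2) :=
  forall A B, measurable A -> sigma_gen [set: nat] W B ->
    P (X @^-1` A `&` B) = (P (X @^-1` A) * P B)%E.

Definition moment {V : normedModType R} (p : R) (X : {RV P >-> borel V}) :
  \bar R := 'E_P[fun w => `|X w : V| `^ p].

Definition moment_root {V : normedModType R} (p : R)
  (X : {RV P >-> borel V}) : \bar R := (moment p X `^ p^-1)%E.

(* Random variables are kept as functions; identities between them below are
   pointwise. *)
Definition in_L {V : normedModType R} (p : R) (X : {RV P >-> borel V}) : Prop :=
  (moment p X < +oo)%E.

End Laws.

(* The infimum ranges over all pairs of random variables with the prescribed
   laws on a common, arbitrary, probability space. *)
Definition wasserstein {R : realType} {V : normedModType R} (r : R)
    (mu nu : probability (borel V) R) : \bar R :=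
  ereal_inf [set c : \bar R |
    exists (d : measure_display) (T : measurableType d) (Q : probability T R)
           (X Y : {RV Q >-> borel V}),
      [/\ forall A, measurable A -> distribution Q X A = mu A,
          forall A, measurable A -> distribution Q Y A = nu A &
          c = ('E_Q[fun w => (`|(X w : V) - (Y w : V)| `^ r)%R] `^ r^-1)%E]].

Record K_infty {R : realType} (alpha : R -> R) : Prop := {
  Kinf_continuous : {within `[0, +oo[, continuous alpha};
  Kinf_increasing : {in `[0, +oo[ &, {homo alpha : x y / x < y}};
  Kinf_unbounded : forall M : R, exists2 x, 0 <= x & M < alpha x;
  Kinf_0 : alpha 0 = 0
}.

Record control_problem {R : realType} (XX UU WW : completeNormedModType R)
    {d : measure_display} {Omega : measurableType d}
    (P : probability Omega R) := ControlProblem {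
  expX : R;
  expU : R;
  dyn : XX -> UU -> WW -> XX;
  noise : nat -> {RV P >-> borel WW};
  noise_law : probability (borel WW) R;
  constr : set ({RV P >-> borel XX} * {RV P >-> borel UU});
  (* only the values on [constr] matter *)
  cost : {RV P >-> borel XX} -> {RV P >-> borel UU} -> R
}.

Section ControlProblem.
Context {R : realType} {XX UU WW : completeNormedModType R}.
Context {d : measure_display} {Omega : measurableType d}.
Context {P : probability Omega R}.
Variable S : control_problem XX UU WW P.

Local Notation rvX := {RV P >-> borel XX}.
Local Notation rvU := {RV P >-> borel UU}.

(* The sigma-algebra on the codomain is the product one; it is the Borel
   sigma-algebra of XX * UU when XX and UU are separable. *)
Definition joint (X : rvX) (U : rvU) : Omega -> borel XX * borel UU :=
  fun w => (X w, U w).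

Definition constrX : set rvX := [set X | exists U, constr S (X, U)].

(* One time step of the constrained control system.  That [X k] lies in L^n
   follows from [constr_in_L] below. *)
Record admissible_step (U : nat -> rvU) (X : nat -> rvX) (k : nat) : Prop := {
  step_dyn : forall w, X k.+1 w = dyn S (X k w) (U k w) (noise S k w);
  step_in_L : in_L (expU S) (U k);
  step_adapted : forall B, measurable B ->
    sigma_gen [set j | (j <= k)%N] X (U k @^-1` B);
  step_constr : constr S (X k, U k);
  step_indep : independent P (noise S k) (joint (X k) (U k))
}.

(* The control sequence [U] is admissible on the horizon N for the initial
   state [X0], and [X] is the trajectory it generates.  Only [U k] for k < N
   and [X k] for k <= N are relevant. *)
Definition admissible (N : nat) (X0 : rvX) (U : nat -> rvU) (X : nat -> rvX) :
  Prop :=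
  [/\ X 0%N = X0, forall k, (k < N)%N -> admissible_step U X k
    & constrX (X N)].

Definition admissible_infty (X0 : rvX) (U : nat -> rvU) (X : nat -> rvX) :
  Prop := X 0%N = X0 /\ forall k, admissible_step U X k.

Definition markov_policy (pi : {mfun borel XX >-> borel UU}) : Prop :=
  forall (X : rvX) (V : rvU), (forall w, V w = pi (X w)) ->
    in_L (expX S) X -> in_L (expU S) V.

Definition markov_step (U : nat -> rvU) (X : nat -> rvX) (k : nat) : Prop :=
  exists2 pi : {mfun borel XX >-> borel UU}, markov_policy pi
    & forall w, U k w = pi (X k w).

Definition markov_admissible (N : nat) (X0 : rvX) (U : nat -> rvU)
    (X : nat -> rvX) : Prop :=
  admissible N X0 U X /\ forall k, (k < N)%N -> markov_step U X k.

Definition markov_admissible_infty (X0 : rvX) (U : nat -> rvU)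
    (X : nat -> rvX) : Prop :=
  admissible_infty X0 U X /\ forall k, markov_step U X k.

(* In [nonempty_admissible] the initial state is taken independent of the
   noise: [step_indep] requires the noise at each time to be independent of
   the current state, and no control can achieve this if, say, the initial
   state is a nonconstant function of the initial noise. *)
Record standing_assumptions : Prop := {
  separable_X : separable XX;
  separable_U : separable UU;
  separable_W : separable WW;
  expX_ge1 : 1 <= expX S;
  expU_ge1 : 1 <= expU S;
  dyn_continuous : {ae noise_law S, forall w : borel WW,
    continuous (fun p : XX * UU => dyn S p.1 p.2 w)};
  noise_distribution : forall k A, measurable A ->
    distribution P (noise S k) A = noise_law S A;
  noise_independent : mutually_independent P (noise S);
  constr_in_L : forall X U, constr S (X, U) ->
    in_L (expX S) X /\ in_L (expU S) U;
  constr_law_invariant : forall X U Y V, constr S (X, U) ->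
    same_law P (joint Y V) (joint X U) -> constr S (Y, V);
  cost_law_invariant : forall X U Y V, constr S (X, U) -> constr S (Y, V) ->
    same_law P (joint X U) (joint Y V) -> cost S X U = cost S Y V;
  nonempty_admissible : forall X0, constrX X0 ->
    independent_of_sequence P X0 (noise S) ->
    exists U X, admissible_infty X0 U X
}.

Definition total_cost (N : nat) (U : nat -> rvU) (X : nat -> rvX) : R :=
  \sum_(k < N) cost S (X k) (U k).

Record stationary_pair (Xs : nat -> rvX) (Us : nat -> rvU) : Prop := {
  stat_admissible : markov_admissible_infty (Xs 0%N) Us Xs;
  stat_lawX : forall k, same_law P (Xs k) (Xs 0%N);
  stat_lawU : forall k, same_law P (Us k) (Us 0%N);
  stat_law : forall k,
    same_law P (joint (Xs k) (Us k)) (joint (Xs 0%N) (Us 0%N))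
}.

(* For a stationary pair the value at time 0 is the value at every time. *)
Definition stationary_cost (Xs : nat -> rvX) (Us : nat -> rvU) : R :=
  cost S (Xs 0%N) (Us 0%N).

(* [rho] is the common law of the [Xs k]. *)
Definition distributional_turnpike
    (dD : probability (borel XX) R -> probability (borel XX) R -> \bar R)
    (Xs : nat -> rvX) (Us : nat -> rvU) : Prop :=
  let rho : probability (borel XX) R := distribution P (Xs 0%N) in
  exists2 alpha3 : R -> R, K_infty alpha3 &
  forall X0, constrX X0 -> exists2 Cc : R, 0 < Cc &
  forall (delta : R) (N : nat) U X (eps : R),
    0 < delta -> (0 < N)%N -> markov_admissible N X0 U X ->
    total_cost N U X <= delta + N%:R * stationary_cost Xs Us ->
    0 < eps ->
    N%:R - (delta + Cc) / alpha3 eps <=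
    #|[pred k : 'I_N.+1 | (dD (distribution P (X k)) rho <= eps%:E)%E]|%:R.

Definition moment_turnpike (s : R) (Xs : nat -> rvX) (Us : nat -> rvU) : Prop :=
  exists2 alpha4 : R -> R, K_infty alpha4 &
  forall X0, constrX X0 -> exists2 Cd : R, 0 < Cd &
  forall (delta : R) (N : nat) U X (eps : R),
    0 < delta -> (0 < N)%N -> markov_admissible N X0 U X ->
    total_cost N U X <= delta + N%:R * stationary_cost Xs Us ->
    0 < eps ->
    N%:R - (delta + Cd) / alpha4 eps <=
    #|[pred k : 'I_N.+1 |
        (`|moment_root s (X k) - moment_root s (Xs k)| <= eps%:E)%E]|%:R.

End ControlProblem.

(* Main.v *)
Require Import Defs.
From mathcomp Require Import all_boot all_order all_algebra.
From mathcomp Require Import all_classical all_reals all_analysis.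
From mathcomp Require Import measurable_realfun.
Import Order.TTheory GRing.Theory Num.Theory.
Local Open Scope ring_scope.

(** The [s]-th moment root is 1-Lipschitz for the Wasserstein distance of order
    [r], whenever [1 <= s <= r] ([moment_root_dist_le_wasserstein]).  Indeed, a
    moment root depends on the law only ([moment_root_law]), so it can be
    computed on any coupling [(X', Y')] of the two laws, where it is the [L^s]
    norm of the real function [`|X'|] (respectively [`|Y'|]).  The triangle
    inequalities in [L^s] and in the state space bound the difference of the
    two by the [L^s] norm of [`|X' - Y'|] ([Lnorm_dist], [Lnorm_monotone]),
    hence by its [L^r] norm, [L^p] norms being nondecreasing in [p] over a
    probability space ([Lnorm_homo]).  Taking the infimum over all couplings
    gives the bound; a minimizing coupling need not exist.

    Consequently each time at which the law of the state is [eps]-close to the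
    stationary law is a time at which the moment roots are [eps]-close, and the
    turnpike property for the moments holds with the comparison function and
    the constants of the one for the Wasserstein distance.

    On a coupling, [X'] and [Y'] are measurable separately, and the inequalities
    above need [`|X' - Y'|] to be measurable: this is where the separability of
    the state space enters ([measurable_norm_diff]). *)

Section NormMeasurability.
Import numFieldNormedType.Exports.
Context {R : realType} {V : normedModType R}.
Local Open Scope classical_set_scope.

Lemma measurable_norm_sub (q : V) :
  measurable_fun [set: borel V] (fun x : borel V => `|(x : V) - q|).
Proof.
apply: (measurability _ (RGenOpens.measurableE R)) => /= _ [_ [a [b ->] <-]].
rewrite setTI; apply: sub_sigma_algebra => /=.
apply: (@open_comp V R (fun x => `|x - q|) _ _ (@interval_open _ _ _ _ _)) => //.
by move=> x _ /=; apply: cvg_norm; apply: cvgB; [exact: cvg_id|exact: cvg_cst].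
Qed.

Lemma measurable_norm :
  measurable_fun [set: borel V] (fun x : borel V => `|x : V|).
Proof.
have := measurable_norm_sub 0.
by congr measurable_fun; apply/funext => x; rewrite subr0.
Qed.

(** Over a dense set of points [q], the infimum of [`|x - q| + `|y - q|] is
    [`|x - y|].  When this set is countable, [`|X - Y| < c] is thus a countable
    union of events that involve [X] and [Y] through their distances to a fixed
    point. *)
Lemma measurable_norm_diff {d} {T : measurableType d} (X Y : T -> borel V) :
  separable V -> measurable_fun [set: T] X -> measurable_fun [set: T] Y ->
  measurable_fun [set: T] (fun w => `|(X w : V) - (Y w : V)|).
Proof.
move=> [D cD dD] mX mY.
apply: (measurability _ (RGenInftyO.measurableE R)) => /= _ [_ [c ->] <-].
rewrite setTI.
pose S (q : V) w := `|(X w : V) - q| + `|(Y w : V) - q|.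
suff -> : (fun w => `|(X w : V) - (Y w : V)|) @^-1` `]-oo, c[ =
    \bigcup_(q in D) S q @^-1` `]-oo, c[.
  rewrite bigcup_set_type; apply: countable_bigcupT_measurable => [|i].
    by rewrite (eq_countable (card_setT _)).
  move: (val i) => q {i}.
  have mS : measurable_fun [set: T] (S q).
    by apply: measurable_funD; apply: (measurableT_comp (measurable_norm_sub q)).
  by rewrite -[X in measurable X]setTI; exact: mS.
apply/seteqP; split => w /=; rewrite in_itv /=.
  move=> XYc.
  (* A point of D within e of X w is within `|X w - Y w| + e of Y w, and the
     two distances add up to less than `|X w - Y w| + 2 e = c. *)
  set e := (c - `|(X w : V) - (Y w : V)|) / 2.
  have e0 : 0 < e by rewrite divr_gt0// subr_gt0.
  have [|q [qX Dq]] := dD (ball (X w : V) e) _ (ball_open _ _).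
    by exists (X w : V); exact: ballxx.
  exists q => //=; rewrite /S in_itv/=.
  move: qX; rewrite -ball_normE /= => qX.
  have : `|(Y w : V) - q| <= `|(X w : V) - (Y w : V)| + `|(X w : V) - q|.
    by rewrite (distrC (X w : V) (Y w)) ler_distD.
  move=> /le_lt_trans; rewrite -ltrBrDl; apply.
  rewrite ltrBrDl addrCA -ltrBrDl.
  have -> : c - `|(X w : V) - (Y w : V)| = e + e by rewrite -splitr.
  exact: ltrD.
move=> [q _] /=; rewrite in_itv /=; apply: le_lt_trans.
by rewrite /S (distrC (Y w : V)) ler_distD.
Qed.

End NormMeasurability.

Section LnormProbability.
Context {R : realType} {d} {T : measurableType d} (Q : probability T R).
Local Open Scope ereal_scope.

(** Lyapunov's inequality: Hoelder's inequality for [`|f| `^ s] and the constant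
    function 1, with the exponent [r / s] and its conjugate. *)
Lemma Lnorm_homo (f : T -> R) (s r : R) :
  measurable_fun [set: T] f -> (0 < s <= r)%R ->
  'N[Q]_s%:E[EFin \o f] <= 'N[Q]_r%:E[EFin \o f].
Proof.
move=> mf /andP[s0]; rewrite le_eqVlt => /predU1P[-> //|sr].
have r0 : (0 < r)%R := lt_trans s0 sr.
have sr1 : (s / r < 1)%R by rewrite ltr_pdivrMr// mul1r.
have mfs : measurable_fun [set: T] (fun x => `|f x| `^ s)%R.
  by apply: (measurableT_comp (measurable_powR s)); exact: measurableT_comp.
have := @hoelder _ T R Q _ (cst 1%R) (r / s)%R ((1 - s / r)^-1)%R mfs
  (measurable_cst _).
rewrite invrK invf_div subrKC invr_gt0 subr_gt0 sr1 divr_gt0//.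
move=> /(_ isT isT erefl).
have -> : 'N[Q]_((1 - s / r)^-1)%:E[EFin \o cst 1%R] = 1.
  by rewrite Lnorm_cst1 [X in X `^ _]probability_setT poweR1r.
rewrite mule1 Lnorm1 unlock invf_div.
under eq_integral => x _ do rewrite /= mulr1 ger0_norm ?powR_ge0//.
under [in leRHS]eq_integral => x _ do
  rewrite /= ger0_norm ?powR_ge0// -powRrM mulrC divfK ?gt_eqF//.
move=> fsr; have := @gt0_ler_poweR _ (s^-1) _ _ _ _ _ fsr.
rewrite -poweRrM mulrAC divff ?gt_eqF// mul1r; apply => //.
- by rewrite invr_ge0 ltW.
- by rewrite in_itv/= leey andbT integral_ge0// => x _; rewrite lee_fin powR_ge0.
- by rewrite in_itv/= leey andbT poweR_ge0.
Qed.

Lemma Lnorm_monotone (f g : T -> R) (s : R) :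
  measurable_fun [set: T] f -> measurable_fun [set: T] g -> (0 < s)%R ->
  (forall x, `|f x| <= `|g x|)%R ->
  'N[Q]_s%:E[EFin \o f] <= 'N[Q]_s%:E[EFin \o g].
Proof.
move=> mf mg s0 fg.
have mp (h : T -> R) : measurable_fun [set: T] h ->
    measurable_fun [set: T] (fun x => (`|h x| `^ s)%:E).
  move=> mh; apply/measurable_EFinP.
  by apply: (measurableT_comp (measurable_powR s)); exact: measurableT_comp.
have i0 (h : T -> R) : 0 <= \int[Q]_x (`|h x| `^ s)%:E.
  by apply: integral_ge0 => x _; rewrite lee_fin powR_ge0.
rewrite unlock /=; apply: gt0_ler_poweR.
- by rewrite invr_ge0 ltW.
- by rewrite in_itv/= leey andbT i0.
- by rewrite in_itv/= leey andbT i0.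
apply: ge0_le_integral => //; [exact: mp|exact: mp|move=> x _].
by rewrite lee_fin ge0_ler_powR ?nnegrE// ltW.
Qed.

(** Finiteness matters: [+oo - +oo] is [-oo] in [\bar R], and its absolute
    value is [+oo]. *)
Lemma Lnorm_dist (f g : T -> R) (s : R) :
  measurable_fun [set: T] f -> measurable_fun [set: T] g -> (1 <= s)%R ->
  'N[Q]_s%:E[EFin \o f] < +oo -> 'N[Q]_s%:E[EFin \o g] < +oo ->
  `|'N[Q]_s%:E[EFin \o f] - 'N[Q]_s%:E[EFin \o g]| <=
    'N[Q]_s%:E[EFin \o (f \- g)%R].
Proof.
move=> mf mg s1 foo goo.
have key (u v : T -> R) : measurable_fun [set: T] u ->
    measurable_fun [set: T] v -> 'N[Q]_s%:E[EFin \o v] < +oo ->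
    'N[Q]_s%:E[EFin \o u] - 'N[Q]_s%:E[EFin \o v] <=
      'N[Q]_s%:E[EFin \o (u \- v)%R].
  move=> mu mv voo; rewrite leeBlDr ?ge0_fin_numE ?Lnorm_ge0//.
  have := @minkowski_EFin _ _ _ Q (u \- v)%R v s (measurable_funB mu mv) mv s1.
  by congr (Lnorm _ _ _ <= _); apply/funext => x /=; rewrite subrK.
have [dge0|/ltW dle0] := leP 0 ('N[Q]_s%:E[EFin \o f] - 'N[Q]_s%:E[EFin \o g]).
  by rewrite gee0_abs// key.
rewrite lee0_abs// fin_num_oppeB ?ge0_fin_numE ?Lnorm_ge0// addeC.
have := key _ _ mg mf foo.
rewrite (_ : (EFin \o (g \- f)%R) = \- (EFin \o (f \- g)%R)) ?oppe_Lnorm//.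
by apply/funext => x /=; rewrite -(opprB (f x)) EFinN.
Qed.

End LnormProbability.

Section Moments.
Context {R : realType} {V : normedModType R}.
Local Open Scope ereal_scope.

Lemma moment_rootE {d} {T : measurableType d} {Q : probability T R}
    (X : {RV Q >-> borel V}) (s : R) :
  moment_root s X = 'N[Q]_s%:E[EFin \o (fun w => `|X w : V|%R)].
Proof.
rewrite /moment_root /moment unlock [in RHS]unlock; congr (_ `^ _).
by apply: eq_integral => w _ /=; rewrite normr_id.
Qed.

Lemma measurable_norm_RV {d} {T : measurableType d} {Q : probability T R}
    (X : {RV Q >-> borel V}) :
  measurable_fun [set: T] (fun w => `|X w : V|%R).
Proof. exact: (measurableT_comp measurable_norm). Qed.

Lemma in_L_moment_root {d} {T : measurableType d} {Q : probability T R}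
    (X : {RV Q >-> borel V}) {s n : R} :
  (0 < s <= n)%R -> in_L n X -> moment_root s X < +oo.
Proof.
move=> sn Xn; apply: (@le_lt_trans _ _ (moment_root n X)).
  by rewrite !moment_rootE; apply: Lnorm_homo => //; exact: measurable_norm_RV.
exact: poweR_lty.
Qed.

(** The two random variables may live on different probability spaces, so that
    moments can be computed on a coupling. *)
Lemma moment_root_law {d1 d2} {T1 : measurableType d1} {T2 : measurableType d2}
    {Q1 : probability T1 R} {Q2 : probability T2 R}
    (X1 : {RV Q1 >-> borel V}) (X2 : {RV Q2 >-> borel V}) (s : R) :
  (forall A, measurable A -> distribution Q1 X1 A = distribution Q2 X2 A) ->
  moment_root s X1 = moment_root s X2.
Proof.
move=> X12; rewrite /moment_root /moment unlock; congr (_ `^ _).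
have mns : measurable_fun [set: borel V]
    (fun x : borel V => (`|x : V| `^ s)%:E).
  apply/measurable_EFinP; apply: (measurableT_comp (measurable_powR s)).
  exact: measurable_norm.
have ns0 (x : borel V) : 0 <= (`|x : V| `^ s)%:E by rewrite lee_fin powR_ge0.
rewrite -(ge0_integral_distribution X1 mns ns0).
rewrite -(ge0_integral_distribution X2 mns ns0).
by apply: eq_measure_integral => A mA _; exact: X12.
Qed.

(** Every coupling [(X', Y')] of the two laws satisfies
    [| N_s(|X'|) - N_s(|Y'|) | <= N_s(|X'| - |Y'|) <= N_s(|X' - Y'|)
    <= N_r(|X' - Y'|)], where [N_p] is the norm of [L^p]. *)
Lemma moment_root_dist_le_wasserstein {d} {T : measurableType d}
    {P : probability T R} (X Y : {RV P >-> borel V}) (r s : R) :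
  separable V -> (1 <= s <= r)%R ->
  moment_root s X < +oo -> moment_root s Y < +oo ->
  `|moment_root s X - moment_root s Y| <=
    wasserstein r (distribution P X) (distribution P Y).
Proof.
move=> sepV /andP[s1 sr] Xoo Yoo.
have s0 : (0 < s)%R := lt_le_trans ltr01 s1.
apply: le_ereal_inf_tmp => _ [d' [T' [Q [X' [Y' [X'X Y'Y ->]]]]]].
move: Xoo Yoo.
rewrite -(moment_root_law _ _ s X'X) -(moment_root_law _ _ s Y'Y) !moment_rootE.
move=> Xoo Yoo.
have mX := measurable_norm_RV X'; have mY := measurable_norm_RV Y'.
have mXY : measurable_fun [set: T'] (fun w => `|(X' w : V) - (Y' w : V)|%R).
  exact: measurable_norm_diff.
apply: (le_trans (Lnorm_dist Q _ _ _ mX mY s1 Xoo Yoo)).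
apply: (@le_trans _ _
    'N[Q]_s%:E[EFin \o (fun w => `|(X' w : V) - (Y' w : V)|%R)]).
  apply: Lnorm_monotone => // [|w]; first exact: measurable_funB.
  by rewrite /= normr_id ler_dist_dist.
apply: (le_trans (Lnorm_homo Q _ s r mXY _)); first by rewrite s0.
rewrite le_eqVlt; apply/predU1P; left; rewrite unlock [in RHS]unlock.
by congr (_ `^ _); apply: eq_integral => w _ /=; rewrite normr_id.
Qed.

End Moments.

Theorem mainTheorem5 (R : realType) (XX UU WW : completeNormedModType R)
    (d : measure_display) (Omega : measurableType d)
    (P : probability Omega R) (S : control_problem XX UU WW P)
    (Xs : nat -> {RV P >-> borel XX}) (Us : nat -> {RV P >-> borel UU})
    (r : R) :
  standing_assumptions S ->
  1 <= r <= expX S ->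
  stationary_pair S Xs Us ->
  distributional_turnpike S (@wasserstein R XX r) Xs Us ->
  forall s : R, 1 <= s <= r -> moment_turnpike S s Xs Us.
Proof.
move=> SA /andP[_ rn] SP [alpha Kalpha tp] s /andP[s1 sr].
have sn : 0 < s <= expX S by rewrite (lt_le_trans ltr01 s1) (le_trans sr rn).
have constrX_fin X : constrX S X -> (moment_root s X < +oo)%E.
  move=> [U XU]; apply: (in_L_moment_root _ sn).
  by have [] := constr_in_L SA XU.
exists alpha => // X0 X0c.
have [C C0 {}tp] := tp X0 X0c; exists C => // delta N U X eps delta0 N0 adm J eps0.
apply: (le_trans (tp delta N U X eps delta0 N0 adm J eps0)).
rewrite ler_nat; apply: subset_leq_card; apply/fintype.subsetP => k; rewrite !inE.
apply: le_trans.
have Xk : constrX S (X k).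
  have [[_ step XN] _] := adm.
  (* The terminal time k = N carries no control; the state is then constrained
     by the last clause of admissibility. *)
  have := ltn_ord k; rewrite ltnS leq_eqVlt => /predU1P[->//|kN].
  by exists (U k); exact: step_constr (step k kN).
have Xs0 : constrX S (Xs 0%N).
  have [[_ step] _] := stat_admissible SP.
  by exists (Us 0%N); exact: step_constr (step 0%N).
rewrite (moment_root_law _ _ s (stat_lawX SP k)).
apply: moment_root_dist_le_wasserstein; [exact: separable_X SA|by rewrite s1| |];
  exact: constrX_fin.
Qed.
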